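(* Let $\Gamma$ be a countable simple graph whose vertex degrees are bounded by $k$, and let a group $H$ act on $\Gamma$ by graph automorphisms with finitely many orbits of vertices and of edges. Then there exists an $H$-invariant probability measure $\mu$ on $C_{k+1}(\Gamma)$.
   Context: For $n\ge 1$, an $n$-colouring of $\Gamma$ is a map $c:V(\Gamma)\to[n]=\{1,\dots,n\}$ with $c(v_1)\neq c(v_2)$ whenever $\{v_1,v_2\}$ is an edge; $C_n(\Gamma)$ is the set of $n$-colourings, viewed as a (closed) subset of $[n]^{V(\Gamma)}$ with the product topology. $[n]^{V(\Gamma)}$ carries the $\sigma$-algebra generated by the sets $A_{v,j}=\{f: f(v)=j\}$ ($v\in V(\Gamma)$, $j\in[n]$), and $C_n(\Gamma)$ the induced one. $H$ acts on $[n]^{V(\Gamma)}$ and on $C_n(\Gamma)$ by $h\cdot f=f\circ h^{-1}$; $\mu$ is $H$-invariant if $\mu(hA)=\mu(A)$ for all measurable $A$ and $h\in H$. *)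

(* Defs.v *)
From Stdlib Require Import Reals List.
Set Implicit Arguments.
Open Scope R_scope.

Definition colouring (V : Type) (adj : V -> V -> Prop) (n : nat) (c : V -> nat) : Prop :=
  (forall v, (1 <= c v <= n)%nat) /\ (forall v w, adj v w -> c v <> c w).

(* Subsets of C_n(Gamma) are predicates on V -> nat (contained in colouring).
   The sigma-algebra on C_n(Gamma) induced from the product sigma-algebra of
   [n]^V, i.e. generated (inside C_n) by the sets A_{v,j} = {f : f v = j}. *)
Inductive cmeasurable (V : Type) (adj : V -> V -> Prop) (n : nat)
  : ((V -> nat) -> Prop) -> Prop :=
| cm_full : cmeasurable adj n (colouring adj n)
| cm_gen (v : V) (j : nat) : (1 <= j <= n)%nat ->
    cmeasurable adj n (fun f => colouring adj n f /\ f v = j)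
| cm_compl (S : (V -> nat) -> Prop) : cmeasurable adj n S ->
    cmeasurable adj n (fun f => colouring adj n f /\ ~ S f)
| cm_union (A : nat -> (V -> nat) -> Prop) : (forall i, cmeasurable adj n (A i)) ->
    cmeasurable adj n (fun f => exists i, A i f).

Definition is_probability_measure (V : Type) (adj : V -> V -> Prop) (n : nat)
  (mu : ((V -> nat) -> Prop) -> R) : Prop :=
  (forall S, cmeasurable adj n S -> 0 <= mu S) /\
  mu (colouring adj n) = 1 /\
  (forall A : nat -> (V -> nat) -> Prop,
     (forall i, cmeasurable adj n (A i)) ->
     (forall i j f, i <> j -> A i f -> A j f -> False) ->
     infinite_sum (fun i => mu (A i)) (mu (fun f => exists i, A i f))).

Definition act_set (V H : Type) (act : H -> V -> V) (inv : H -> H)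
  (h : H) (S : (V -> nat) -> Prop) : (V -> nat) -> Prop :=
  fun g => exists f, S f /\ g = (fun v => f (act (inv h) v)).

(* Main.v *)
(** Give every pair (vertex, round) an independent fair bit.  A vertex is selected
    in a round when its bit is 1 and the bits of its at most k neighbours are 0.
    Selected vertices are pairwise non-adjacent, so in each round all selected
    vertices that are still uncoloured can simultaneously take the least colour
    not used by their neighbours; this colour is at most k+1.  A vertex is selected
    in a given round with probability at least 2^-(k+1), independently over the
    rounds, so almost surely every vertex gets coloured.  The rule commutes with
    graph automorphisms and the law of the bits is invariant under permuting the
    vertices, so the law of the colouring is H-invariant.

    The bits are the binary digits of a uniform point of [0,1[.  Their law is
    invariant under flipping one bit, hence a bit is independent of every event that
    ignores it; this determines the measure of all cylinders, whence the
    invariance under injective reindexing. *)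

Require Import Defs.
From Stdlib Require Import Reals List Lia Lra Classical ClassicalEpsilon.
From Stdlib Require Import FunctionalExtensionality PropExtensionality.
From Stdlib Require Cantor.
From mathcomp Require all_boot all_order all_algebra.
From mathcomp Require all_classical all_reals all_analysis Rstruct Rstruct_topology.

Set Implicit Arguments.

(** * Events on a family of bits, and the axioms of a fair-coin law *)

Inductive bit_event (I : Type) : ((I -> bool) -> Prop) -> Prop :=
| bit_event_true : bit_event (fun _ => True)
| bit_event_bit (i : I) : bit_event (fun b => b i = true)
| bit_event_not (A : (I -> bool) -> Prop) : bit_event A -> bit_event (fun b => ~ A b)
| bit_event_exists (A : nat -> (I -> bool) -> Prop) :
    (forall n, bit_event (A n)) -> bit_event (fun b => exists n, A n b).

Definition ignores (I : Type) (A : (I -> bool) -> Prop) (i : I) : Prop :=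
  forall b c, (forall j, j <> i -> b j = c j) -> A b -> A c.

(** An interface of plain predicates and real numbers, through which the combinatorial argument uses
    the measure. The law is a total function, constrained only on bit events. *)
Record fair_bits (I : Type) (P : ((I -> bool) -> Prop) -> R) : Prop := {
  fair_ge0 : forall A, bit_event A -> (0 <= P A)%R;
  fair_total : P (fun _ => True) = 1%R;
  fair_split : forall A B, bit_event A -> bit_event B ->
    P A = (P (fun b => A b /\ B b) + P (fun b => A b /\ ~ B b))%R;
  fair_sigma_additive : forall A : nat -> (I -> bool) -> Prop,
    (forall n, bit_event (A n)) -> (forall n m b, n <> m -> A n b -> A m b -> False) ->
    infinite_sum (fun n => P (A n)) (P (fun b => exists n, A n b));
  fair_half : forall A i a, bit_event A -> ignores A i ->
    P (fun b => A b /\ b i = a) = (P A / 2)%R;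
  fair_reindex : forall (s : I -> I) A, (forall i j, s i = s j -> i = j) -> bit_event A ->
    P (fun b => A (fun i => b (s i))) = P A }.

(** * Fair bits from the binary digits of a uniform point *)

Module FairBits.
Import all_boot all_order all_algebra all_classical all_reals all_analysis.
Import Order.TTheory GRing.Theory Num.Theory numFieldNormedType.Exports.
Set Implicit Arguments.
Unset Strict Implicit.
Unset Printing Implicit Defensive.
Local Open Scope classical_set_scope.
Local Open Scope ring_scope.

(** * The product sigma-algebra on families of bits *)

Definition bit_set (I : Type) : set (set (I -> bool)) :=
  range (fun i => [set b : I -> bool | b i]).

Notation bits I := (g_sigma_algebraType (@bit_set I)).

Lemma measurable_bit (I : Type) (i : I) (a : bool) :
  measurable ([set b | b i = a] : set (bits I)).
Proof.
have H : measurable ([set b | b i] : set (bits I)) by apply: sub_sigma_algebra; exists i.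
case: a; first exact: H.
have -> : [set b : bits I | b i = false] = ~` [set b | b i].
  by apply/seteqP; split=> b /= => [->|] //; case: (b i).
exact: measurableC.
Qed.

Lemma measurable_to_bits d (X : measurableType d) (I : Type) (f : X -> bits I) :
  (forall i, measurable [set x | f x i]) -> measurable_fun setT f.
Proof.
move=> H; apply: (@measurability _ _ X (bits I) setT f (@bit_set I)) => //.
by move=> _ [_ [i _ <-] <-]; rewrite setTI; exact: H.
Qed.

Lemma bits_sub_sigma (I : Type) (G : set (set (I -> bool))) :
  (forall i, <<s G >> [set b | b i]) ->
  forall E : set (bits I), measurable E -> <<s G >> E.
Proof.
move=> H; apply: smallest_sub; first exact: smallest_sigma_algebra.
by move=> _ [i _ <-]; exact: H.
Qed.

Lemma pushforward_measure d d' (X : measurableType d) (Y : measurableType d')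
    (R : realType) (m : {measure set X -> \bar R}) (f : X -> Y) :
  measurable_fun setT f ->
  exists m' : {measure set Y -> \bar R}, forall A, m' A = m (f @^-1` A).
Proof.
move=> mf.
unshelve refine (ex_intro _ (pushforward m f : {measure set Y -> \bar R}) _).
  exact: mf.
by [].
Qed.

(** * Binary prefixes and the digits of a real number *)

(** The first [n] bits read as a binary number, bit 0 being the most significant. *)
Fixpoint prefix_val (b : nat -> bool) (n : nat) : nat :=
  if n is n'.+1 then b n' + (prefix_val b n').*2 else 0%N.

Lemma prefix_val_inj (b c : nat -> bool) n :
  prefix_val b n = prefix_val c n <-> forall i, (i < n)%N -> b i = c i.
Proof.
elim: n => [|n IH] //=; split.
- move=> E.
  have Eb : b n = c n by have := congr1 odd E; rewrite !oddD !odd_double !addbF !oddb.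
  have : prefix_val b n = prefix_val c n.
    by have := congr1 half E; rewrite Eb !half_bit_double.
  move/IH => H i; rewrite ltnS leq_eqVlt => /orP[/eqP->//|]; exact: H.
- move=> H; rewrite H // (IH.2 _) // => i ilt; apply: H; exact: ltnW.
Qed.

Lemma prefix_val_lt b n : (prefix_val b n < 2 ^ n)%N.
Proof.
elim: n => [|n IH] //=; rewrite expnS mul2n.
by case: (b n); rewrite ?add1n ?add0n ?ltn_Sdouble ?ltn_double.
Qed.

Section Digits.
Variable R : realType.

Definition digit (x : R) (n : nat) : bool := odd (Num.truncn (2 ^+ n.+1 * x)).

(** Halving [N <= 2 * y < N + 1] places [y] between [N./2] and [N./2 + 1], because the parity bit of
    [N] is at most 1. *)
Lemma truncn_double (y : R) : 0 <= y -> (Num.truncn (2 * y))./2 = Num.truncn y.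
Proof.
move=> y0; apply/esym/truncn_def.
have y20 : 0 <= 2 * y by rewrite mulr_ge0.
have := truncn_itv y20; set N := Num.truncn _ => /andP[N1 N2].
have e : N%:R = (odd N)%:R + 2 * (N./2)%:R :> R.
  by rewrite -{1}(odd_double_half N) natrD -mul2n natrM.
apply/andP; split.
- rewrite -(@ler_pM2l _ 2) //; apply: le_trans N1; rewrite e lerDr; exact: ler0n.
- rewrite -(@ltr_pM2l _ 2) //; apply: lt_le_trans N2 _.
  rewrite -natr1 e -[(N./2).+1%:R]natr1 mulrDr mulr1 addrC addrA addrC lerD2l.
  by rewrite -(natrD _ 1) ler_nat; case: odd.
Qed.

Lemma prefix_val_digit (x : R) n : 0 <= x < 1 ->
  prefix_val (digit x) n = Num.truncn (2 ^+ n * x).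
Proof.
move=> /andP[x0 x1]; elim: n => [|n IH] /=.
  by rewrite expr0 mul1r; apply/esym/truncn_def; rewrite x0.
rewrite IH -truncn_double ?mulr_ge0 ?exprn_ge0 // mulrA -exprS.
exact: odd_double_half.
Qed.

(** Truncation sends negative numbers to 0, so the fibre is a dyadic interval only for positive [j].
    Odd values, the only ones that matter for a digit, are positive. *)
Lemma truncn_setE n j : (0 < j)%N ->
  [set x : R | Num.truncn (2 ^+ n * x) = j] = `[j%:R / 2 ^+ n, j.+1%:R / 2 ^+ n[%classic.
Proof.
move=> j0; apply/seteqP; split=> x /=; rewrite in_itv /= ler_pdivrMr ?ltr_pdivlMr ?exprn_gt0 //
  ![x * _]mulrC.
- move=> E; have h : 0 <= 2 ^+ n * x.
    rewrite leNgt; apply/negP => h; move: E j0.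
    by rewrite truncn_floor leNgt h /= => <-.
  by rewrite -E; exact: truncn_itv.
- exact: truncn_def.
Qed.

Lemma measurable_digit :
  measurable_fun setT (digit : measurableTypeR R -> bits nat).
Proof.
apply: measurable_to_bits => i.
have -> : [set x | digit x i] =
   \bigcup_(j in [set j | odd j]) [set x : R | Num.truncn (2 ^+ i.+1 * x) = j].
  apply/seteqP; split=> [x /= h|x [j /= oj E]]; last by rewrite /digit E.
  by exists (Num.truncn (2 ^+ i.+1 * x)).
apply: bigcup_measurable => j /= oj.
by rewrite truncn_setE; [exact: measurable_itv|case: j oj].
Qed.

Lemma lebesgue_prefix b n :
  @lebesgue_measure R
    ([set x | prefix_val (digit x) n = prefix_val b n] `&` `[0, 1[%classic)
  = ((2 ^+ n)^-1 : R)%:E.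
Proof.
set j := prefix_val b n.
have p0 : 0 < (2 ^+ n : R) by rewrite exprn_gt0.
have -> : [set x | prefix_val (digit x) n = j] `&` `[0, 1[%classic
   = `[j%:R / 2 ^+ n, j.+1%:R / 2 ^+ n[%classic.
  apply/seteqP; split => x /=.
  - rewrite in_itv /= => -[+ x01]; rewrite prefix_val_digit // => E.
    have /andP[x0 _] := x01.
    rewrite in_itv /= ler_pdivrMr ?ltr_pdivlMr // ![x * _]mulrC -E.
    by apply: truncn_itv; rewrite mulr_ge0 // ltW.
  - rewrite in_itv /= ler_pdivrMr ?ltr_pdivlMr // ![x * _]mulrC => E.
    have x01 : 0 <= x < 1.
      move: E => /andP[E1 E2]; apply/andP; split.
        by rewrite -(pmulr_rge0 _ p0); apply: le_trans E1.
      (* A prefix of length [n] has value below [2 ^ n], so the dyadic interval does not pass 1. *)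
      rewrite -(ltr_pM2l p0) mulr1; apply: lt_le_trans E2 _.
      by rewrite -natrX ler_nat; exact: prefix_val_lt.
    by rewrite in_itv /= prefix_val_digit //; split => //; exact: truncn_def.
rewrite lebesgue_measure_itv /= lte_fin ltr_pM2r ?invr_gt0 // ltr_nat ltnSn.
by rewrite -EFinB -mulrBl -natrB // subSnn mul1r.
Qed.

End Digits.

(** * Prefix sets as an intersection-stable generating family *)

Definition prefix_set (n : nat) (b : nat -> bool) : set (nat -> bool) :=
  [set c | forall i, (i < n)%N -> c i = b i].

Lemma prefix_setE n b : prefix_set n b = [set c | prefix_val c n = prefix_val b n].
Proof. by apply/seteqP; split=> c /=; rewrite prefix_val_inj. Qed.

(** The empty set is added because incompatible prefixes have no common extension. *)
Definition prefix_sets : set (set (nat -> bool)) :=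
  [set A | A = set0 \/ exists n, exists b, A = prefix_set n b].

Lemma prefix_setsI : setI_closed prefix_sets.
Proof.
move=> A B [->|[n [b ->]]]; first by rewrite set0I; left.
move=> [->|[m [c ->]]]; first by rewrite setI0; left.
have [->|/set0P[d [db dc]]] := eqVneq (prefix_set n b `&` prefix_set m c) set0; first by left.
(* Any common point [d] of two compatible prefix sets provides the longer prefix. *)
right; exists (maxn n m), d; apply/seteqP; split=> x /=.
- move=> [h1 h2] i; rewrite leq_max => /orP[] h; [by rewrite h1 // db|by rewrite h2 // dc].
- move=> h; split=> i lt; have /h -> : (i < maxn n m)%N by rewrite leq_max lt ?orbT.
  + exact: db.
  + exact: dc.
Qed.

Lemma measurable_prefix n b : measurable (prefix_set n b : set (bits nat)).
Proof.
have -> : prefix_set n b = \bigcap_(i in [set i | (i < n)%N]) [set c | c i = b i] by [].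
by apply: bigcap_measurableType => i _; exact: measurable_bit.
Qed.

(** Bit [i] is the parity of the prefix value of length [i.+1], so the event is a countable union,
    over odd values, of sets that are empty or prefix sets. *)
Lemma bit_prefix_sigma i : <<s prefix_sets >> [set b | b i].
Proof.
have -> : [set b | b i] = \bigcup_(j in [set j | odd j])
    ([set b | prefix_val b i.+1 = j] : set (nat -> bool)) :> set (nat -> bool).
  have P b : odd (prefix_val b i.+1) = b i by rewrite /= oddD odd_double addbF oddb.
  apply/seteqP; split=> [b h|b [j oj E]]; last by rewrite /= -P E.
  by exists (prefix_val b i.+1) => //=; rewrite -/prefix_val P.
apply: (@bigcup_measurable _ (g_sigma_algebraType prefix_sets)) => j _.
apply: sub_sigma_algebra.
have [->|/set0P[b <-]] := eqVneq [set b | prefix_val b i.+1 = j] set0; first by left.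
by right; exists i.+1, b; rewrite prefix_setE.
Qed.


(** The law is the image under [digit] of Lebesgue measure restricted to the unit interval. *)
Lemma fair_bits_nat (R : realType) :
  exists P : {measure set (bits nat) -> \bar R},
    P setT = 1%E /\ forall n b, P (prefix_set n b) = ((2 ^+ n)^-1 : R)%:E.
Proof.
have m01 : measurable (`[0, 1[%classic : set (measurableTypeR R)).
  exact: measurable_itv.
have [P HP] := pushforward_measure
  (mrestr (@lebesgue_measure R) m01 : {measure set _ -> \bar R}) (@measurable_digit R).
have H n b : P (prefix_set n b) = ((2 ^+ n)^-1 : R)%:E.
  rewrite HP -(lebesgue_prefix R b n) prefix_setE /mrestr.
  by congr (lebesgue_measure (_ `&` _)).
exists P; split=> //.
have -> : setT = prefix_set 0 (fun=> false) by apply/seteqP; split.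
by rewrite H expr0 invr1.
Qed.

(** * Flipping one bit, and the independence that it implies *)

Definition flip (I : eqType) (i : I) (b : I -> bool) : I -> bool :=
  fun j => if j == i then ~~ b j else b j.

Lemma measurable_flip (I : eqType) (i : I) : measurable_fun setT (flip i : bits I -> bits I).
Proof.
apply: measurable_to_bits => j; rewrite /flip; case: eqP => _.
- have -> : [set x : bits I | ~~ x j] = [set b | b j = false].
    by apply/seteqP; split=> x /=; [move/negbTE|move->].
  exact: measurable_bit.
- exact: measurable_bit j true.
Qed.

(* Flips permute the prefix sets of each length, which generate the events. *)
Lemma flip_invariant (R : realType) (P : {measure set (bits nat) -> \bar R}) :
  P setT = 1%E -> (forall n b, P (prefix_set n b) = ((2 ^+ n)^-1 : R)%:E) ->
  forall i (A : set (bits nat)), measurable A -> P (flip i @^-1` A) = P A.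
Proof.
move=> P1 PE i A mA.
have [Q HQ] := pushforward_measure P (measurable_flip i).
rewrite -HQ.
(* Measures that agree on an intersection-stable generating family coincide. The required exhaustion
   by sets of finite measure is constantly [setT], the prefix set of length 0. *)
apply: (@g_sigma_algebra_measure_unique _ R (bits nat) prefix_sets _ (fun=> setT) _ _ Q P).
- by move=> _ [->|[n [b ->]]]; [exact: measurable0|exact: measurable_prefix].
- by move=> _; right; exists 0%N, (fun=> false); apply/seteqP; split.
- by apply/seteqP; split=> // x _; exists 0%N.
- exact: prefix_setsI.
- move=> _ [->|[n [b ->]]]; first by rewrite !measure0.
  rewrite HQ; transitivity (P (prefix_set n (flip i b))); last by rewrite !PE.
  congr (P _); apply/seteqP; split=> c /= h j /h; rewrite /flip; case: eqP => // _.
  + by move=> <-; rewrite negbK.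
  + by move=> ->; rewrite negbK.
- by move=> _; rewrite HQ preimage_setT P1 ltry.
- exact: (bits_sub_sigma bit_prefix_sigma).
Qed.

(** The flip preserves [A] and exchanges its two parts [b i = a] and [b i = ~~ a], which therefore
    have equal measure and add up to [P A]. *)
Lemma half_nat (R : realType) (P : {measure set (bits nat) -> \bar R}) :
  P setT = 1%E -> (forall n b, P (prefix_set n b) = ((2 ^+ n)^-1 : R)%:E) ->
  forall i a (A : set (bits nat)), measurable A -> (forall b, A b -> A (flip i b)) ->
  P (A `&` [set b | b i = a]) = (2^-1%:E * P A)%E.
Proof.
move=> P1 PE i a A mA Ai.
have mB c : measurable (A `&` [set b | b i = c]).
  by apply: measurableI => //; exact: measurable_bit.
have E : P (A `&` [set b | b i = ~~ a]) = P (A `&` [set b | b i = a]).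
  rewrite -(flip_invariant P1 PE i) //; congr (P _); apply/seteqP; split=> b /= [Ab].
  - rewrite /flip eqxx => h; split; last by rewrite -[a]negbK -h negbK.
    have -> : b = flip i (flip i b).
      by apply/funext => j; rewrite /flip; case: eqP => // _; rewrite negbK.
    exact: Ai.
  - by move=> h; split; [exact: Ai|rewrite /flip eqxx h].
have S : P A = (P (A `&` [set b | b i = a]) + P (A `&` [set b | b i = ~~ a]))%E.
  rewrite -measureU //; last first.
    by apply/seteqP; split=> // b /= [[_ ->]] [_]; case: a {E}.
  congr (P _); apply/seteqP; split=> b /=; last by case=> -[].
  move=> Ab; have [->|/eqP h] := eqVneq (b i) a; first by left.
  by right; split=> //; case: (b i) a h {E} => -[].
rewrite S E ge0_muleDr // -ge0_muleDl ?lee_fin ?invr_ge0 //.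
have -> : (2^-1%:E + 2^-1%:E = 1 :> \bar R)%E.
  by rewrite -EFinD -[2^-1]mul1r -splitr.
by rewrite mul1e.
Qed.

(** * Cylinders and invariance under injective reindexing *)

Definition cylinder (I : Type) (l : seq (I * bool)) : set (I -> bool) :=
  [set b | forall p, List.In p l -> b p.1 = p.2].

Lemma cylinder_cons (I : Type) (p : I * bool) l :
  cylinder (p :: l) = cylinder l `&` [set b | b p.1 = p.2].
Proof.
apply/seteqP; split=> b /=.
- by move=> h; split=> [q ql|]; apply: h; [right|left].
- by move=> [h hp] q [<-//|]; exact: h.
Qed.

Lemma measurable_cylinder (I : Type) (l : seq (I * bool)) :
  measurable (cylinder l : set (bits I)).
Proof.
elim: l => [|p l IH].
- have -> : @cylinder I [::] = setT by apply/seteqP; split=> // b _ p [].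
  exact: measurableT.
- by rewrite cylinder_cons; apply: measurableI => //; exact: measurable_bit.
Qed.

Lemma ignores_cylinder (I : Type) (l : seq (I * bool)) i :
  (forall a, ~ List.In (i, a) l) -> ignores (cylinder l) i.
Proof.
move=> il b c bc h p pl; rewrite -bc ?h // => e.
by apply: (il p.2); rewrite -e -surjective_pairing.
Qed.

Lemma In_map (T U : Type) (f : T -> U) (s : seq T) y :
  List.In y [seq f x | x <- s] <-> exists x, f x = y /\ List.In x s.
Proof. exact: List.in_map_iff. Qed.

(** Induction on the list: a repeated constraint changes nothing, a contradictory one makes both
    cylinders empty, a fresh index halves both measures. Injectivity of [s] makes the same case
    occur on both sides. *)
Lemma cylinder_measure_reindex (R : realType) (I : Type)
    (m : {measure set (bits I) -> \bar R}) :
  (forall i a (A : set (bits I)), measurable A -> ignores A i ->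
     m (A `&` [set b | b i = a]) = (2^-1%:E * m A)%E) ->
  forall s : I -> I, injective s -> forall l,
  m (cylinder [seq (s p.1, p.2) | p <- l]) = m (cylinder l).
Proof.
move=> half s sI; elim=> [|[i a] l IH] //=.
rewrite !cylinder_cons /=.
have In_s j c : List.In (s j, c) [seq (s p.1, p.2) | p <- l] <-> List.In (j, c) l.
  by rewrite In_map; split=> [[[k d] [[/sI -> ->]]]//|h]; exists (j, c).
have [ia|nia] := pselect (List.In (i, a) l).
  rewrite !setIidl //; first by move=> b h; exact: (h (i, a)).
  by move=> b h; apply: (h (s i, a)); apply/In_s.
have [ina|nina] := pselect (List.In (i, ~~ a) l).
  have E0 j l' : List.In (j, ~~ a) l' -> cylinder l' `&` [set b | b j = a] = set0.
    by move=> jl; apply/seteqP; split=> // b /= [/(_ _ jl) /= ->]; case: (a).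
  by rewrite !E0 //; apply/In_s.
have il c : ~ List.In (i, c) l.
  by have [->|] := eqVneq c a => //; case: c a nia nina => -[].
rewrite !half ?IH //; try exact: measurable_cylinder; apply: ignores_cylinder => c //.
by move/In_s; exact: il.
Qed.

(** The image of [m] under reindexing agrees with [m] on cylinders. These generate the events, and
    concatenating lists intersects them. *)
Lemma bits_measure_reindex (R : realType) (I : Type)
    (m : {measure set (bits I) -> \bar R}) :
  m setT = 1%E ->
  (forall i a (A : set (bits I)), measurable A -> ignores A i ->
     m (A `&` [set b | b i = a]) = (2^-1%:E * m A)%E) ->
  forall s : I -> I, injective s -> forall A : set (bits I), measurable A ->
  m [set b | A (fun i => b (s i))] = m A.
Proof.
move=> m1 half s sI A mA.
have ms : measurable_fun setT ((fun b i => b (s i)) : bits I -> bits I).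
  by apply: measurable_to_bits => i; exact: (measurable_bit (s i) true).
have [Q HQ] := pushforward_measure m ms.
transitivity (Q A); first by rewrite HQ.
pose G : set (set (I -> bool)) := range (@cylinder I).
have cylT : setT = @cylinder I [::] by apply/seteqP; split=> // b _ p [].
apply: (@g_sigma_algebra_measure_unique _ R (bits I) G _ (fun=> setT) _ _ Q m).
- by move=> _ [l _ <-]; exact: measurable_cylinder.
- by move=> _; exists [::].
- by apply/seteqP; split=> // x _; exists 0%N.
- move=> _ _ [l _ <-] [l' _ <-]; exists (l ++ l') => //; apply/seteqP; split=> b /=.
  + by move=> h; split=> p pl; apply: h; apply/List.in_app_iff; [left|right].
  + by move=> [h h'] p /List.in_app_iff[]; [exact: h|exact: h'].
- move=> _ [l _ <-]; rewrite -(cylinder_measure_reindex half sI) HQ; congr (m _).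
  apply/seteqP; split=> b /= h p.
  + by rewrite In_map => -[q [<- ql]]; exact: h.
  + by move=> pl; apply: (h (s p.1, p.2)); rewrite In_map; exists p.
- by move=> _; rewrite HQ preimage_setT m1 ltry.
- apply: bits_sub_sigma mA => i; apply: sub_sigma_algebra; exists [:: (i, true)] => //.
  by rewrite cylinder_cons -cylT setTI.
Qed.

(** The bits are read off a fair sequence at the positions [enc i]. Since [enc] is injective,
    flipping position [enc i] alters coordinate [i] alone. *)
Lemma fair_measure (R : realType) (I : Type) (enc : I -> nat) : injective enc ->
  exists m : {measure set (bits I) -> \bar R}, m setT = 1%E /\
  forall i a (A : set (bits I)), measurable A -> ignores A i ->
     m (A `&` [set b | b i = a]) = (2^-1%:E * m A)%E.
Proof.
move=> encI; have [P [P1 PE]] := fair_bits_nat R.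
have me : measurable_fun setT ((fun b i => b (enc i)) : bits nat -> bits I).
  by apply: measurable_to_bits => i; exact: (measurable_bit (enc i) true).
have [m Hm] := pushforward_measure P me.
exists m; split; first by rewrite Hm preimage_setT.
move=> i a A mA Ai; rewrite !Hm -(@half_nat _ P P1 PE (enc i) a) //.
  by rewrite -[X in measurable X]setTI; exact: me.
move=> b; apply: Ai => j ji; rewrite /flip; case: eqP => // /encI; contradiction.
Qed.

(** * From measures to real-valued laws on predicates *)

Lemma measurable_bit_event (I : Type) (A : set (bits I)) : bit_event A -> measurable A.
Proof.
elim=> [|i|{}A _ mA|F _ mF].
- exact: measurableT.
- exact: (measurable_bit i true).
- exact: measurableC.
- have -> : (fun b => exists n, F n b) = \bigcup_n F n.
    by apply/seteqP; split=> [b [n h]|b [n _ h]]; exists n.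
  exact: bigcupT_measurable.
Qed.

Import Rstruct Rstruct_topology.

Lemma ex_fair_bits (I : Type) (enc : I -> nat) :
  (forall i j, enc i = enc j -> i = j) ->
  exists P : ((I -> bool) -> Prop) -> R, fair_bits P.
Proof.
move=> encI; have [m [m1 half]] := fair_measure R encI.
have mfinm A : measurable A -> m A \is a fin_num.
  move=> mA; rewrite ge0_fin_numE //.
  apply: le_lt_trans (ltry 1); rewrite -m1; apply: le_measure; rewrite ?inE //.
have mfin A : bit_event A -> m A \is a fin_num by move/measurable_bit_event/mfinm.
exists (fun A => fine (m A)); split.
- by move=> A _; apply/RleP; exact: fine_ge0.
- by rewrite -[fun=> True]/setT m1.
- move=> A B eA eB; have mA := measurable_bit_event eA; have mB := measurable_bit_event eB.
  have mAB : measurable (A `&` B : set (bits I)) by exact: measurableI.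
  have mAC : measurable (A `&` ~` B : set (bits I)).
    by apply: measurableI => //; exact: measurableC.
  rewrite RplusE -[A in LHS]setIT -(setUv B) setIUr measureU //.
    by rewrite fineD ?mfinm.
  by rewrite setIACA setICr setI0.
- move=> A eA dA.
  have mA n := measurable_bit_event (eA n).
  have eU := bit_event_exists A eA.
  have UE : (fun b => exists n, A n b) = \bigcup_n A n.
    by apply/seteqP; split=> [b [n h]|b [n _ h]]; exists n.
  have := @measure_semi_sigma_additive _ _ _ m A mA.
  rewrite -UE => /(_ _ (measurable_bit_event eU)) H.
  have {}H : (\sum_(0 <= i < n) m (A i))%E @[n --> \oo] -->
      (fine (m (fun b => exists n, A n b)))%:E.
    rewrite fineK ?mfin //; apply: H; apply/trivIsetP => i j _ _ /eqP ij.
    by apply/seteqP; split=> // b [hi hj]; exact: dA ij hi hj.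
  have {}H := fine_cvg H _.
  move=> e /RltP e0; have [N _ HN] := (cvgrPdist_lt (F := \oo) _ _).1 (H _) _ e0.
  exists N => n nN; apply/RltP; rewrite RdistE distrC.
  (* [sum_f_R0] includes its last index, so the partial sum at [n] has [n.+1] terms. *)
  have := HN n.+1 (leqW (introT ssrnat.leP nN)); rewrite /= sum_f_R0E.
  by rewrite sum_fine // => i _; exact: mfin.
- move=> A i a eA Ai; rewrite RdivE.
  have -> : (fun b => A b /\ b i = a) = A `&` [set b | b i = a] by [].
  have two : IZR 2 = 2%:R :> R by [].
  rewrite half //; last exact: measurable_bit_event.
  by rewrite fineM ?mfin // mulrC two.
- move=> s A sI eA; congr fine; apply: (bits_measure_reindex m1 half sI).
  exact: measurable_bit_event.
Qed.
End FairBits.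

Local Open Scope nat_scope.

Lemma set_ext (T : Type) (A B : T -> Prop) : (forall x, A x <-> B x) -> A = B.
Proof.
  intros h; apply functional_extensionality; intro x; apply propositional_extensionality; auto.
Qed.

(** * Events depending on countably many bits *)

Section Events.
Variable I : Type.
Implicit Types A B : (I -> bool) -> Prop.

Lemma bit_event_ext A B : bit_event A -> (forall b, A b <-> B b) -> bit_event B.
Proof. intros hA h; rewrite <- (set_ext A B h); exact hA. Qed.

Lemma bit_event_const (p : Prop) : bit_event (fun _ : I -> bool => p).
Proof.
  destruct (classic p).
  - apply bit_event_ext with (1 := @bit_event_true I); tauto.
  - apply bit_event_ext with (1 := bit_event_not (@bit_event_true I)); tauto.
Qed.

Lemma bit_event_or A B : bit_event A -> bit_event B -> bit_event (fun b => A b \/ B b).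
Proof.
  intros hA hB.
  apply bit_event_ext with (A := fun b => exists n, match n with 0 => A b | _ => B b end).
  - apply bit_event_exists with (A := fun n b => match n with 0 => A b | _ => B b end).
    intros [|n]; assumption.
  - intro b; split.
    + intros [[|n] h]; tauto.
    + intros [h|h]; [exists 0|exists 1]; exact h.
Qed.

Lemma bit_event_and A B : bit_event A -> bit_event B -> bit_event (fun b => A b /\ B b).
Proof.
  intros hA hB.
  apply bit_event_ext with (A := fun b => ~ (~ A b \/ ~ B b)).
  - apply bit_event_not, bit_event_or; apply bit_event_not; assumption.
  - intro b; tauto.
Qed.

(** The union is reindexed by codes: a code belongs to at most one [x], and a code of no [x]
    contributes the impossible event. *)
Lemma bit_event_ex (X : Type) (enc : X -> nat) (F : X -> (I -> bool) -> Prop) :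
  (forall x y, enc x = enc y -> x = y) -> (forall x, bit_event (F x)) ->
  bit_event (fun b => exists x, F x b).
Proof.
  intros inj hF.
  apply bit_event_ext with (A := fun b => exists n, exists x, enc x = n /\ F x b).
  - apply bit_event_exists with (A := fun n b => exists x, enc x = n /\ F x b); intro n.
    destruct (classic (exists x, enc x = n)) as [[x hx]|no].
    + apply bit_event_ext with (1 := hF x).
      intro b; split; [eauto|].
      intros [y [hy h]]; rewrite (inj x y); congruence.
    + apply bit_event_ext with (1 := bit_event_const False); firstorder.
  - intro b; split; [intros [n [x [_ h]]]; eauto|intros [x h]; eauto].
Qed.

Lemma bit_event_all (X : Type) (enc : X -> nat) (F : X -> (I -> bool) -> Prop) :
  (forall x y, enc x = enc y -> x = y) -> (forall x, bit_event (F x)) ->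
  bit_event (fun b => forall x, F x b).
Proof.
  intros inj hF.
  apply bit_event_ext with (A := fun b => ~ exists x, ~ F x b).
  - apply bit_event_not, bit_event_ex with (enc := enc); [exact inj|].
    intro x; apply bit_event_not, hF.
  - intro b; split; [intros h x; apply NNPP; firstorder|firstorder].
Qed.

Lemma bit_event_imp (p : Prop) A : bit_event A -> bit_event (fun b => p -> A b).
Proof.
  intro hA; apply bit_event_ext with (A := fun b => ~ p \/ A b).
  - apply bit_event_or; [apply bit_event_const|exact hA].
  - intro b; tauto.
Qed.

Lemma bit_event_eq (i : I) (a : bool) : bit_event (fun b => b i = a).
Proof.
  destruct a; [apply bit_event_bit|].
  apply bit_event_ext with (1 := bit_event_not (bit_event_bit i)).
  intro b; destruct (b i); split; congruence.
Qed.

End Events.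

(** * Null events and finite patterns of bits *)

Section Probability.
Variables (I : Type) (P : ((I -> bool) -> Prop) -> R).
Hypothesis HP : fair_bits P.
Implicit Types A B : (I -> bool) -> Prop.

Lemma fair_mono A B : bit_event A -> bit_event B -> (forall b, A b -> B b) -> (P A <= P B)%R.
Proof.
  intros hA hB h.
  rewrite (fair_split HP hB hA), (set_ext (fun b => B b /\ A b) A) by firstorder.
  pose proof (fair_ge0 HP (bit_event_and hB (bit_event_not hA))); lra.
Qed.

Lemma fair_not A : bit_event A -> P (fun b => ~ A b) = (1 - P A)%R.
Proof.
  intro hA; rewrite <- (fair_total HP), (fair_split HP (@bit_event_true I) hA).
  rewrite (set_ext (fun b => True /\ A b) A), (set_ext (fun b => True /\ ~ A b) (fun b => ~ A b))
    by tauto.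
  lra.
Qed.

(** Additivity concerns disjoint sequences, so [A n] is replaced by [D n], where [n] is the first
    index whose event occurs. *)
Lemma fair_null_exists (A : nat -> (I -> bool) -> Prop) :
  (forall n, bit_event (A n)) -> (forall n, P (A n) = 0%R) -> P (fun b => exists n, A n b) = 0%R.
Proof.
  intros hA h0.
  set (D := fun n b => A n b /\ forall m, m < n -> ~ A m b).
  assert (hD : forall n, bit_event (D n)).
  { intro n; apply bit_event_and; [apply hA|].
    apply bit_event_all with (enc := fun m : nat => m); [auto|].
    intro m; apply bit_event_imp, bit_event_not, hA. }
  assert (D0 : forall n, P (D n) = 0%R).
  { intro n; apply Rle_antisym; [|apply (fair_ge0 HP), hD].
    rewrite <- (h0 n); apply fair_mono; [apply hD|apply hA|firstorder]. }
  rewrite (set_ext (fun b => exists n, A n b) (fun b => exists n, D n b)).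
  - assert (S := fair_sigma_additive HP D hD).
    rewrite (functional_extensionality (fun n => P (D n)) (fun _ => 0%R) D0) in S.
    eapply uniqueness_sum; [apply S|].
    + intros n m b nm [h1 h2] [h3 h4].
      destruct (Nat.lt_total n m) as [l|[l|l]]; firstorder.
    + intros eps he; exists 0; intros n _; rewrite sum_cte.
      unfold Rdist; rewrite Rmult_0_l, Rminus_diag, Rabs_R0; exact he.
  - intro b; split; [|firstorder].
    intros [n hn]; revert hn; induction n as [n IH] using (well_founded_induction Nat.lt_wf_0).
    intro hn; destruct (classic (exists m, m < n /\ A m b)) as [[m [l hm]]|no].
    + exact (IH m l hm).
    + exists n; split; [exact hn|firstorder].
Qed.

(** Each listed index contributes a factor 1/2: as the list has no repetition, [A] together with the
    constraints at the later indices ignores it. *)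
Lemma fair_pattern (a : I -> bool) (l : list I) A :
  NoDup l -> bit_event A -> (forall i, In i l -> ignores A i) ->
  P (fun b => A b /\ forall i, In i l -> b i = a i) = (P A * (1 / 2) ^ length l)%R.
Proof.
  intros nd hA; induction nd as [|i l il nd IH]; intro ig; simpl.
  - rewrite (set_ext (fun b => A b /\ forall i, False -> b i = a i) A) by tauto; lra.
  - rewrite (set_ext _ (fun b => (A b /\ forall j, In j l -> b j = a j) /\ b i = a i)).
    + rewrite (fair_half HP), IH; [lra|firstorder| |].
      * apply bit_event_and; [exact hA|].
        clear IH ig nd il; induction l as [|j l IH].
        -- apply bit_event_ext with (1 := @bit_event_true I); simpl; tauto.
        -- apply bit_event_ext with (1 := bit_event_and (bit_event_eq j (a j)) IH).
           intro b; simpl; split; [intros [h1 h2] k [<-|h]; auto|auto].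
      * intros b c bc [h1 h2]; split.
        -- apply (ig i (or_introl eq_refl)) with b; assumption.
        -- intros j hj; rewrite <- bc; [auto|congruence].
    + intro b; split; [firstorder|].
      intros [[h1 h2] h3]; split; [exact h1|intros j [<-|h]; auto].
Qed.

End Probability.

(** * The random colouring *)

Section Process.
Variables (V : Type) (adj : V -> V -> Prop).

Definition selected (b : V * nat -> bool) (t : nat) (v : V) : Prop :=
  b (v, t) = true /\ forall w, adj v w -> b (w, t) = false.

(* [v] has received colour [j] before round [t]: in each round the selected
   uncoloured vertices take the least positive colour unused by their neighbours. *)
Fixpoint coloured (b : V * nat -> bool) (t : nat) (v : V) (j : nat) : Prop :=
  match t with
  | 0 => False
  | S t' => coloured b t' v j \/
      ((forall i, ~ coloured b t' v i) /\ selected b t' v /\ 1 <= j /\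
       (forall w, adj v w -> ~ coloured b t' w j) /\
       (forall i, 1 <= i < j -> exists w, adj v w /\ coloured b t' w i))
  end.

Lemma coloured_mono b t t' v j : t <= t' -> coloured b t v j -> coloured b t' v j.
Proof. induction 1; simpl; auto. Qed.

(** A coloured vertex is never recoloured, and two colours taken in one round are both the least
    free one. *)
Lemma coloured_functional b t v i j : coloured b t v i -> coloured b t v j -> i = j.
Proof.
  revert i j; induction t as [|t IH]; simpl; [tauto|].
  intros i j [hi|[ni [_ [i1 [fi mi]]]]] [hj|[nj [_ [j1 [fj mj]]]]]; [eauto|firstorder|firstorder|].
  destruct (Nat.lt_total i j) as [l|[l|l]]; [|exact l|].
  - destruct (mj i) as [w [vw hw]]; [lia|]; destruct (fi w vw hw).
  - destruct (mi j) as [w [vw hw]]; [lia|]; destruct (fj w vw hw).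
Qed.

(** A new colour avoids those already held by neighbours, and two neighbours are never selected in
    the same round. *)
Lemma coloured_proper (adj_sym : forall v w, adj v w -> adj w v) b t v w j :
  adj v w -> coloured b t v j -> coloured b t w j -> False.
Proof.
  intro vw; induction t as [|t IH]; simpl; [tauto|].
  intros [hv|[_ [sv [_ [fv _]]]]] [hw|[_ [sw [_ [fw _]]]]]; [tauto| | |].
  - exact (fw v (adj_sym v w vw) hv).
  - exact (fv w vw hw).
  - destruct sv as [sv _], sw as [_ sw]; rewrite (sw v (adj_sym v w vw)) in sv; discriminate.
Qed.

Lemma coloured_event (enc : V -> nat) (inj : forall v w, enc v = enc w -> v = w) t v j :
  bit_event (fun b => coloured b t v j).
Proof.
  revert v j; induction t as [|t IH]; intros v j; simpl; [apply bit_event_const|].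
  apply bit_event_or; [apply IH|].
  apply bit_event_and; [apply bit_event_all with (enc := fun i : nat => i); auto|].
  { intro i; apply bit_event_not, IH. }
  apply bit_event_and.
  { apply bit_event_and; [apply bit_event_eq|].
    apply bit_event_all with (enc := enc); [exact inj|]; intro w.
    apply bit_event_imp, bit_event_eq. }
  apply bit_event_and; [apply bit_event_const|].
  apply bit_event_and.
  - apply bit_event_all with (enc := enc); [exact inj|]; intro w.
    apply bit_event_imp, bit_event_not, IH.
  - apply bit_event_all with (enc := fun i : nat => i); [auto|]; intro i.
    apply bit_event_imp, bit_event_ex with (enc := enc); [exact inj|]; intro w.
    apply bit_event_and; [apply bit_event_const|apply IH].
Qed.

(** The rule refers to the graph through adjacency alone, so it commutes with an automorphism acting
    on both vertices and bits. *)
Lemma coloured_equivariant (g g' : V -> V) :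
  (forall v, g (g' v) = v) -> (forall v w, adj v w <-> adj (g v) (g w)) ->
  forall b t v j,
  coloured (fun p => b (g (fst p), snd p)) t v j <-> coloured b t (g v) j.
Proof.
  intros gg' gadj b; induction t as [|t IH]; intros v j; simpl; [tauto|].
  (* Surjectivity of [g] makes the neighbours of [g v] exactly the images of the neighbours of
     [v]. *)
  assert (all : forall Q : V -> Prop,
      (forall w, adj v w -> Q (g w)) <-> (forall w, adj (g v) w -> Q w)).
  { intro Q; split; intros h w vw.
    - rewrite <- (gg' w); apply h, (proj2 (gadj _ _)); rewrite gg'; exact vw.
    - apply h, (proj1 (gadj _ _)), vw. }
  assert (S : selected (fun p => b (g (fst p), snd p)) t v <-> selected b t (g v)).
  { unfold selected; simpl; rewrite (all (fun w => b (w, t) = false)); tauto. }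
  assert (F : (forall w, adj v w -> ~ coloured (fun p => b (g (fst p), snd p)) t w j) <->
              (forall w, adj (g v) w -> ~ coloured b t w j)).
  { rewrite <- (all (fun w => ~ coloured b t w j)); split; intros h w vw; specialize (h w vw);
      rewrite IH in *; exact h. }
  assert (E : forall i, (exists w, adj v w /\ coloured (fun p => b (g (fst p), snd p)) t w i) <->
              (exists w, adj (g v) w /\ coloured b t w i)).
  { intro i; split; intros [w [vw h]].
    - exists (g w); rewrite <- gadj, <- IH; auto.
    - exists (g' w); rewrite IH, gg', gadj, gg'; auto. }
  rewrite S, F, IH; setoid_rewrite E; setoid_rewrite IH; tauto.
Qed.

(** * Bounded degree: enough colours, and selection almost surely *)

Section BoundedDegree.
Variable k : nat.
Hypothesis deg_le : forall v l, NoDup l -> (forall w, In w l -> adj v w) -> length l <= k.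

(** A vertex holds at most one colour, so neighbours chosen for [m] different colours are [m]
    different neighbours. *)
Lemma neighbours_of_colours b t v m :
  (forall i, 1 <= i <= m -> exists w, adj v w /\ coloured b t w i) ->
  m <= k.
Proof.
  intro h.
  assert (exists l, NoDup l /\ length l = m /\
     forall w, In w l -> adj v w /\ exists i, 1 <= i <= m /\ coloured b t w i) as [l [nd [len hl]]].
  { induction m as [|m IH].
    - exists nil; split; [constructor|split; [reflexivity|simpl; tauto]].
    - destruct IH as [l [nd [len hl]]]; [intros i hi; apply h; lia|].
      destruct (h (S m)) as [w [vw hw]]; [lia|].
      exists (w :: l); split; [|split; [simpl; congruence|]].
      + constructor; [|exact nd]; intro hin; destruct (hl w hin) as [_ [i [hi hc]]].
        assert (i = S m) by (eapply coloured_functional; eassumption); lia.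
      + intros u [<-|hu].
        * split; [exact vw|exists (S m); split; [lia|exact hw]].
        * destruct (hl u hu) as [vu [i [hi hc]]]; split; [exact vu|].
          exists i; split; [lia|exact hc]. }
  rewrite <- len; apply (@deg_le v); firstorder.
Qed.

Lemma coloured_range b t v j : coloured b t v j -> 1 <= j <= S k.
Proof.
  induction t as [|t IH]; simpl; [tauto|].
  intros [h|[_ [_ [j1 [_ hm]]]]]; [auto|]; split; [exact j1|].
  assert (j - 1 <= k); [|lia].
  apply neighbours_of_colours with (b := b) (t := t) (v := v); intros i hi; apply hm; lia.
Qed.

(** If none of the [S k] colours were free, they would occur on [S k] distinct neighbours. Hence a
    free colour exists, and descent reaches the least one. *)
Lemma selected_coloured b t v : selected b t v -> exists j, coloured b (S t) v j.
Proof.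
  intro s; destruct (classic (exists i, coloured b t v i)) as [[i hi]|no].
  { exists i; left; exact hi. }
  set (free := fun j => 1 <= j /\ forall w, adj v w -> ~ coloured b t w j).
  assert (exists j, free j) as [j hj].
  { apply NNPP; intro nf.
    assert (S k <= k); [|lia].
    apply neighbours_of_colours with (b := b) (t := t) (v := v); intros i hi.
    apply NNPP; intro ni; apply nf; exists i; split; [lia|firstorder]. }
  induction j as [j IH] using (well_founded_induction Nat.lt_wf_0).
  destruct (classic (exists i, i < j /\ free i)) as [[i [ij hi]]|least]; [eauto|].
  exists j; right; split; [firstorder|split; [exact s|split; [apply hj|split; [apply hj|]]]].
  intros i hi; apply NNPP; intro ni; apply least; exists i; split; [lia|].
  split; [lia|firstorder].
Qed.

Lemma neighbour_list v : exists l, NoDup l /\ forall w, In w l <-> adj v w.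
Proof.
  assert (forall n l, NoDup l -> (forall w, In w l -> adj v w) -> k <= length l + n ->
     exists l, NoDup l /\ forall w, In w l <-> adj v w) as ext.
  (* [n] is fuel: a list of neighbours is extended until complete, and the degree bound forbids
     going beyond length [k]. *)
  { induction n as [|n IH]; intros l nd hl len;
      (destruct (classic (exists w, adj v w /\ ~ In w l)) as [[w [vw wl]]|no];
       [|exists l; split; [exact nd|]; intro w; split; [apply hl|];
         intro vw; apply NNPP; firstorder]);
      assert (nd' : NoDup (w :: l)) by (constructor; assumption);
      assert (hl' : forall u, In u (w :: l) -> adj v u) by (intros u [<-|hu]; auto).
    - pose proof (deg_le nd' hl'); simpl in *; lia.
    - apply (IH (w :: l)); simpl in *; auto; lia. }
  apply (ext k nil); [constructor|simpl; tauto|lia].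
Qed.


(** Different rounds use disjoint sets of bits, so the probability of no selection decays
    geometrically in the number of rounds. *)
Lemma never_selected_null (enc : V -> nat) (inj : forall v w, enc v = enc w -> v = w)
    (adj_irr : forall v, ~ adj v v) P :
  fair_bits P -> forall v, P (fun b => forall t, ~ selected b t v) = 0%R.
Proof.
  intros HP v.
  destruct (neighbour_list v) as [l [nd hl]].
  (* The probability of selection in one round: one bit for [v] and one for each neighbour are
     prescribed. *)
  set (q := ((1 / 2) ^ S (length l))%R).
  assert (q01 : (0 < q <= 1)%R).
  { unfold q; split; [apply pow_lt; lra|].
    pose proof (pow_incr (1 / 2) 1 (S (length l))) as le1; rewrite pow1 in le1; apply le1; lra. }
  assert (selE : forall t, bit_event (fun b => selected b t v)).
  { intro t; apply bit_event_and; [apply bit_event_eq|].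
    apply bit_event_all with (enc := enc); [exact inj|]; intro w.
    apply bit_event_imp, bit_event_eq. }
  set (none := fun T b => forall t, t < T -> ~ selected b t v).
  assert (noneE : forall T, bit_event (none T)).
  { intro T; apply bit_event_all with (enc := fun t : nat => t); [auto|]; intro t.
    apply bit_event_imp, bit_event_not, selE. }
  assert (step : forall T, P (none (S T)) = (P (none T) * (1 - q))%R).
  { intro T.
    set (a := fun p : V * nat => if excluded_middle_informative (fst p = v) then true else false).
    assert (av : a (v, T) = true)
      by (unfold a; simpl; destruct (excluded_middle_informative _); congruence).
    assert (aw : forall w, adj v w -> a (w, T) = false).
    { intros w vw; unfold a; simpl; destruct (excluded_middle_informative _); [|reflexivity].
      subst; destruct (adj_irr _ vw). }
    pose proof (fair_split HP (noneE T) (selE T)) as sp.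
    assert (pat : P (fun b => none T b /\ selected b T v) = (P (none T) * q)%R).
    { rewrite (set_ext _ (fun b => none T b /\
        forall p, In p (map (fun w => (w, T)) (v :: l)) -> b p = a p)).
      - rewrite (fair_pattern HP); [rewrite length_map; reflexivity| |apply noneE|].
        + apply NoDup_map_NoDup_ForallPairs; [intros x y _ _ e; congruence|].
          constructor; [rewrite hl; apply adj_irr|exact nd].
        (* [none T] concerns rounds before [T], hence ignores every bit of round [T]. *)
        + intros p hp b c bc hb t tT [sv sw].
          apply in_map_iff in hp; destruct hp as [u [<- _]].
          assert (bct : forall w, b (w, t) = c (w, t)).
          { intro w; apply bc; intro e; injection e; lia. }
          apply (hb t tT); split; [rewrite bct; exact sv|].
          intros w vw; rewrite bct; auto.
      - intro b; unfold selected; split; intros [h1 h2]; (split; [exact h1|]).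
        + intros p hp; apply in_map_iff in hp; destruct hp as [u [<- [<-|hu]]].
          * rewrite av; apply h2.
          * rewrite aw by (apply hl, hu); apply h2, hl, hu.
        + split; [rewrite <- av; apply h2, in_map_iff; exists v; simpl; auto|].
          intros w vw; rewrite <- (aw w vw); apply h2, in_map_iff.
          exists w; split; [reflexivity|right; apply hl, vw]. }
    rewrite (set_ext (none (S T)) (fun b => none T b /\ ~ selected b T v)); [lra|].
    intro b; unfold none; split.
    - intro h; split; [intros t tT|]; apply h; lia.
    - intros [h1 h2] t tT; destruct (Nat.eq_dec t T) as [->|]; [exact h2|apply h1; lia]. }
  assert (geom : forall T, P (none T) = ((1 - q) ^ T)%R).
  { induction T as [|T IH]; simpl.
    - rewrite <- (fair_total HP); f_equal; apply set_ext; unfold none.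
      intro b; split; [tauto|lia].
    - rewrite step, IH; ring. }
  assert (neverE : bit_event (fun b => forall t, ~ selected b t v)).
  { apply bit_event_all with (enc := fun t : nat => t); [auto|]; intro t.
    apply bit_event_not, selE. }
  apply Rle_antisym; [|apply (fair_ge0 HP), neverE].
  apply Rnot_lt_le; intro pos.
  (* If the limit event had positive probability, some power of [1 - q] would fall below it, against
     monotonicity. *)
  destruct (@pow_lt_1_zero (1 - q)) with (2 := pos) as [N hN].
  { rewrite Rabs_pos_eq; lra. }
  specialize (hN N (Nat.le_refl N)); rewrite <- geom, Rabs_pos_eq in hN
    by (apply (fair_ge0 HP), noneE).
  apply (Rlt_not_le _ _ hN), (fair_mono HP neverE (noneE N)); unfold none; auto.
Qed.

End BoundedDegree.

(** * The colouring produced by the bits, and its law *)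

Definition yields (b : V * nat -> bool) (f : V -> nat) : Prop :=
  forall v, exists t, coloured b t v (f v).

(** The preimage of [S] under the partial map from bits to colourings. Bits that leave some vertex
    uncoloured forever belong to no such preimage. *)
Definition colouring_event (S : (V -> nat) -> Prop) (b : V * nat -> bool) : Prop :=
  exists f, S f /\ yields b f.

Lemma yields_functional b f g : yields b f -> yields b g -> f = g.
Proof.
  intros hf hg; apply functional_extensionality; intro v.
  destruct (hf v) as [t ht], (hg v) as [s hs].
  apply coloured_functional with (b := b) (t := max t s) (v := v);
    [apply coloured_mono with (2 := ht)|apply coloured_mono with (2 := hs)]; lia.
Qed.

Lemma yields_colouring k
  (deg_le : forall v l, NoDup l -> (forall w, In w l -> adj v w) -> length l <= k)
  (adj_sym : forall v w, adj v w -> adj w v) b f : yields b f -> colouring adj (S k) f.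
Proof.
  intro hf; split.
  - intro v; destruct (hf v) as [t ht]; exact (coloured_range deg_le _ _ _ _ ht).
  - intros v w vw e; destruct (hf v) as [t ht], (hf w) as [s hs]; rewrite <- e in hs.
    apply coloured_proper with (b := b) (t := max t s) (v := v) (w := w) (j := f v); auto;
      [apply coloured_mono with (2 := ht)|apply coloured_mono with (2 := hs)]; lia.
Qed.

(** The bits reindexed by [g] yield [f] exactly when the original bits yield [f] composed with
    [g']. *)
Lemma colouring_event_equivariant (g g' : V -> V) :
  (forall v, g (g' v) = v) -> (forall v, g' (g v) = v) ->
  (forall v w, adj v w <-> adj (g v) (g w)) -> forall S b,
  colouring_event (fun c => exists f, S f /\ c = (fun v => f (g' v))) b <->
  colouring_event S (fun p => b (g (fst p), snd p)).
Proof.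
  intros gg' g'g gadj S b; split.
  - intros [c [[f [hf ->]] hc]]; exists f; split; [exact hf|].
    intro v; destruct (hc (g v)) as [t ht]; exists t.
    rewrite g'g in ht; apply (coloured_equivariant _ _ gg' gadj); exact ht.
  - intros [f [hf hc]]; exists (fun v => f (g' v)); split; [eauto|].
    intro v; destruct (hc (g' v)) as [t ht]; exists t.
    apply (coloured_equivariant _ _ gg' gadj) in ht; rewrite gg' in ht; exact ht.
Qed.

Section Law.
Variables (enc : V -> nat) (k : nat).
Hypothesis inj : forall v w, enc v = enc w -> v = w.
Hypothesis adj_sym : forall v w, adj v w -> adj w v.
Hypothesis adj_irr : forall v, ~ adj v v.
Hypothesis deg_le : forall v l, NoDup l -> (forall w, In w l -> adj v w) -> length l <= k.

Lemma colouring_event_full b :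
  colouring_event (colouring adj (S k)) b <-> forall v, exists j t, coloured b t v j.
Proof.
  split.
  - intros [f [_ hf]] v; exists (f v); apply hf.
  - intro h.
    pose (f := fun v => proj1_sig (constructive_indefinite_description _ (h v))).
    assert (hf : yields b f).
    { intro v; exact (proj2_sig (constructive_indefinite_description _ (h v))). }
    exists f; split; [exact (yields_colouring deg_le adj_sym hf)|exact hf].
Qed.

(** Induction on the generation of the set. As the bits yield at most one colouring, complements
    pull back to complements within the event that all vertices get coloured. *)
Lemma colouring_event_measurable S' :
  cmeasurable adj (S k) S' -> bit_event (colouring_event S').
Proof.
  assert (full : bit_event (colouring_event (colouring adj (S k)))).
  { apply bit_event_ext with (A := fun b => forall v, exists j t, coloured b t v j).
    - apply bit_event_all with (enc := enc); [exact inj|]; intro v.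
      apply bit_event_exists with (A := fun j b => exists t, coloured b t v j); intro j.
      apply bit_event_exists with (A := fun t b => coloured b t v j); intro t.
      exact (coloured_event enc inj t v j).
    - intro b; rewrite colouring_event_full; tauto. }
  induction 1 as [|v j hj|S' hS IH|A hA IH].
  - exact full.
  - apply bit_event_ext with (A := fun b => colouring_event (colouring adj (S k)) b /\
      exists t, coloured b t v j).
    + apply bit_event_and; [exact full|].
      apply bit_event_exists with (A := fun t b => coloured b t v j); intro t.
      exact (coloured_event enc inj t v j).
    + intro b; split.
      * intros [[f [hc hf]] [t ht]]; exists f; split; [split; [exact hc|]|exact hf].
        destruct (hf v) as [s hs].
        apply coloured_functional with (b := b) (t := max t s) (v := v);
          [apply coloured_mono with (2 := hs)|apply coloured_mono with (2 := ht)]; lia.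
      * intros [f [[hc <-] hf]]; split; [exists f; auto|apply hf].
  - apply bit_event_ext with (A := fun b => colouring_event (colouring adj (S k)) b /\
      ~ colouring_event S' b).
    + apply bit_event_and; [exact full|apply bit_event_not, IH].
    + intro b; split.
      * intros [[f [hc hf]] hn]; exists f; split; [split; [exact hc|]|exact hf].
        intro hS'; apply hn; exists f; auto.
      * intros [f [[hc hn] hf]]; split; [exists f; auto|].
        intros [g [hg hyg]]; rewrite (yields_functional hf hyg) in hn; auto.
  - apply bit_event_ext with (A := fun b => exists i, colouring_event (A i) b).
    + apply bit_event_exists with (A := fun i => colouring_event (A i)); exact IH.
    + intro b; unfold colouring_event; firstorder.
Qed.

Lemma law_probability P : fair_bits P ->
  is_probability_measure adj (S k) (fun S' => P (colouring_event S')).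
Proof.
  intro HP; split; [|split].
  - intros S' hS; apply (fair_ge0 HP), colouring_event_measurable, hS.
  (* Total mass 1: where the colouring is incomplete, some vertex is never selected. [bad n] treats
     the vertex of code [n] and is impossible when there is none, so the union is over natural
     numbers. *)
  - set (bad := fun n b => exists v, enc v = n /\ forall t, ~ selected b t v).
    assert (neverE : forall v, bit_event (fun b => forall t, ~ selected b t v)).
    { intro v; apply bit_event_all with (enc := fun t : nat => t); [auto|]; intro t.
      apply bit_event_not, bit_event_and; [apply bit_event_eq|].
      apply bit_event_all with (enc := enc); [exact inj|]; intro w.
      apply bit_event_imp, bit_event_eq. }
    assert (badE : forall n, bit_event (bad n)).
    { intro n; apply bit_event_ex with (enc := enc); [exact inj|]; intro v.
      apply bit_event_and; [apply bit_event_const|apply neverE]. }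
    assert (fullE := colouring_event_measurable (@cm_full V adj (S k))).
    assert (P (fun b => exists n, bad n b) = 0%R) as null.
    { apply (fair_null_exists HP); [exact badE|]; intro n.
      destruct (classic (exists v, enc v = n)) as [[v hv]|no].
      - rewrite <- (never_selected_null deg_le enc inj adj_irr HP v).
        f_equal; apply set_ext; intro b; split.
        + intros [w [hw h]]; replace v with w by (apply inj; congruence); exact h.
        + intro h; exists v; auto.
      - rewrite (set_ext (bad n) (fun b => ~ True)) by (unfold bad; firstorder).
        rewrite (fair_not HP (@bit_event_true _)), (fair_total HP); ring. }
    assert (P (fun b => ~ colouring_event (colouring adj (S k)) b) <= 0)%R as le0.
    { rewrite <- null; apply (fair_mono HP).
      - apply bit_event_not, fullE.
      - apply bit_event_exists, badE.
      - intros b h; apply NNPP; intro nb; apply h, colouring_event_full; intro v.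
        destruct (classic (exists t, selected b t v)) as [[t ht]|no].
        + destruct (selected_coloured deg_le ht) as [j hj]; eauto.
        + destruct nb; exists (enc v), v; split; [reflexivity|firstorder]. }
    pose proof (fair_ge0 HP (bit_event_not fullE)); rewrite (fair_not HP fullE) in *; lra.
  - intros A hA disj.
    rewrite (set_ext (colouring_event (fun f => exists i, A i f))
               (fun b => exists i, colouring_event (A i) b))
      by (unfold colouring_event; firstorder).
    apply (fair_sigma_additive HP) with (A := fun i => colouring_event (A i)).
    + intro n; apply colouring_event_measurable, hA.
    (* Disjointness survives the pullback because the yielded colouring is unique. *)
    + intros n m b nm [f [hf yf]] [g [hg yg]].
      rewrite <- (yields_functional yf yg) in hg; exact (disj n m f nm hf hg).
Qed.

End Law.
End Process.

Theorem theorem5p3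
  (* the graph: countable vertex set, simple *)
  (V : Type) (adj : V -> V -> Prop)
  (Vcount : exists enc : V -> nat, forall v w, enc v = enc w -> v = w)
  (adj_sym : forall v w, adj v w -> adj w v)
  (adj_irr : forall v, ~ adj v v)
  (* degrees bounded by k *)
  (k : nat)
  (deg_le : forall (v : V) (l : list V), NoDup l -> (forall w, In w l -> adj v w) ->
              (length l <= k)%nat)
  (* a group H *)
  (H : Type) (mul : H -> H -> H) (inv : H -> H) (e : H)
  (mulA : forall a b c, mul a (mul b c) = mul (mul a b) c)
  (mul1g : forall a, mul e a = a)
  (mulVg : forall a, mul (inv a) a = e)
  (* acting on Gamma by graph automorphisms *)
  (act : H -> V -> V)
  (act1 : forall v, act e v = v)
  (actM : forall g h v, act (mul g h) v = act g (act h v))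
  (act_adj : forall h v w, adj v w <-> adj (act h v) (act h w))
  (* finitely many orbits of vertices *)
  (fin_vorb : exists reps : list V, forall v, exists r, In r reps /\ exists h, act h r = v)
  (* finitely many orbits of edges *)
  (fin_eorb : exists es : list (V * V),
      (forall p, In p es -> adj (fst p) (snd p)) /\
      forall a b, adj a b -> exists p, In p es /\ exists h,
        (act h (fst p) = a /\ act h (snd p) = b) \/ (act h (fst p) = b /\ act h (snd p) = a)) :
  exists mu : ((V -> nat) -> Prop) -> R,
    is_probability_measure adj (S k) mu /\
    forall (h : H) (A : (V -> nat) -> Prop), cmeasurable adj (S k) A ->
      mu (act_set act inv h A) = mu A.
Proof.
  destruct Vcount as [enc inj].
  assert (pair_inj : forall p q : V * nat,
      Cantor.to_nat (enc (fst p), snd p) = Cantor.to_nat (enc (fst q), snd q) -> p = q).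
  { intros [v t] [w s] vw_ts; apply Cantor.to_nat_inj in vw_ts; simpl in vw_ts.
    injection vw_ts; intros -> vw; rewrite (inj v w vw); reflexivity. }
  destruct (FairBits.ex_fair_bits pair_inj) as [P HP].
  exists (fun S' => P (colouring_event adj S')); split.
  - exact (law_probability _ _ inj adj_sym adj_irr deg_le HP).
  - intros h A hA.
    assert (actVg : forall a v, act (inv a) (act a v) = v).
    { intros a v; rewrite <- actM, mulVg; apply act1. }
    assert (actgV : forall a v, act a (act (inv a) v) = v).
    (* The axioms give left inverses; applying the inverse of [inv a] turns this into cancellation
       on the other side. *)
    { intros a v; rewrite <- (actVg (inv a) (act a (act (inv a) v))), (actVg a); apply actVg. }
    (* Translating the set of colourings by [h] amounts to reindexing the bits by the injective map
       that moves vertices by [h] and fixes rounds. *)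
    rewrite (set_ext (colouring_event adj (act_set act inv h A))
               (fun b => colouring_event adj A (fun p => b (act h (fst p), snd p)))).
    + apply (fair_reindex HP) with (s := fun p => (act h (fst p), snd p)).
      * intros [v t] [w s] eq_act; simpl in eq_act; injection eq_act; intros -> hvw.
        rewrite <- (actVg h v), hvw, actVg; reflexivity.
      * exact (colouring_event_measurable _ inj adj_sym deg_le hA).
    + exact (colouring_event_equivariant _ _ _ (actgV h) (actVg h) (act_adj h) A).
Qed.
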